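(* Let $0 < \delta < 1$ and $0 < \alpha < \beta < 1$ with $\frac{\alpha}{\beta} + \frac{\alpha}{2} \leq \frac{1}{2}$. Let $X_1, X_2, \ldots$ be a sequence of independent and identically distributed Bernoulli random variables having the same distribution as $X$, where $\Pr\{X = 1\} = 1 - \Pr\{X = 0\} = p \in (0,1)$. Define $$A = \frac{1}{\ln 4 - 1}\cdot\frac{\ln\frac{2}{\delta}}{\alpha\beta}, \qquad B = \left(\frac{\alpha}{\beta} + \alpha\right) A.$$ Let $L$ and $W$ be real numbers such that $L \geq A$ and $W \geq B$. Define $$\boldsymbol{m} = \min\left\{ n \in \mathbb{N} : n > L \ \text{ or } \ \sum_{i=1}^n X_i > W \right\}, \qquad \widehat{\boldsymbol{p}} = \frac{1}{\boldsymbol{m}} \sum_{i=1}^{\boldsymbol{m}} X_i.$$ Then $$\Pr\left\{ |\widehat{\boldsymbol{p}} - p| < \alpha \ \text{ or } \ \left|\frac{\widehat{\boldsymbol{p}} - p}{p}\right| < \beta \right\} > 1 - \delta.$$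
   Context: $\mathbb{N}$ denotes the set of positive integers, $\ln$ the natural logarithm, and $\Pr\{\cdot\}$ the probability of an event. *)

(* Defs.v *)
From HB Require Import structures.
From mathcomp Require Import all_boot all_order all_algebra finmap.
From mathcomp Require Import all_classical all_reals all_analysis.

Set Implicit Arguments.
Unset Strict Implicit.
Unset Printing Implicit Defensive.

Import Order.TTheory GRing.Theory Num.Theory.
Import numFieldNormedType.Exports.

Local Open Scope classical_set_scope.
Local Open Scope ring_scope.

Definition mutually_independent d (T : measurableType d) (R : realType)
    (P : probability T R) (Xs : nat -> {RV P >-> R}) : Prop :=
  forall (J : {fset nat}) (B : nat -> set R),
    (forall i, i \in J -> measurable (B i)) ->
    P (\bigcap_(i in [set` J]) (Xs i @^-1` B i)) =
    (\prod_(i <- J) P (Xs i @^-1` B i))%E.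

Definition same_distribution d (T : measurableType d) (R : realType)
    (P : probability T R) (X Y : {RV P >-> R}) : Prop :=
  forall B : set R, measurable B -> distribution P X B = distribution P Y B.

Definition iid_as d (T : measurableType d) (R : realType)
    (P : probability T R) (X : {RV P >-> R}) (Xs : nat -> {RV P >-> R}) : Prop :=
  mutually_independent Xs /\ (forall i, same_distribution (Xs i) X).

(* Only the law is constrained: [X] may leave {0, 1} on a null set. *)
Definition bernoulli_rv d (T : measurableType d) (R : realType)
    (P : probability T R) (p : R) (X : {RV P >-> R}) : Prop :=
  P [set t | X t = 1] = p%:E /\ P [set t | X t = 0] = (1 - p)%:E.

Definition A_bound (R : realType) (delta alpha beta : R) : R :=
  1 / (ln 4 - 1) * (ln (2 / delta) / (alpha * beta)).

Definition B_bound (R : realType) (delta alpha beta : R) : R :=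
  (alpha / beta + alpha) * A_bound delta alpha beta.

(* Observations are indexed from 0: [Xs i] is the (i+1)-st observation, so that
   [psum Xs n t] is the sum of the first [n] observations at the outcome [t]. *)
Definition psum d (T : measurableType d) (R : realType)
    (P : probability T R) (Xs : nat -> {RV P >-> R}) (n : nat) (t : T) : R :=
  \sum_(i < n) Xs i t.

Definition stops d (T : measurableType d) (R : realType)
    (P : probability T R) (Xs : nat -> {RV P >-> R}) (L W : R) (t : T) :
    pred nat :=
  fun n => (0 < n)%N && ((L < n%:R) || (W < psum Xs n t)).

Lemma stops_ex d (T : measurableType d) (R : realType)
    (P : probability T R) (Xs : nat -> {RV P >-> R}) (L W : R) (t : T) :
  exists n, stops Xs L W t n.
Proof.
by exists (Num.truncn L).+1; rewrite /stops real_truncnS_gt // num_real.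
Qed.

Definition sample_number d (T : measurableType d) (R : realType)
    (P : probability T R) (Xs : nat -> {RV P >-> R}) (L W : R) (t : T) : nat :=
  ex_minn (stops_ex Xs L W t).

Definition p_hat d (T : measurableType d) (R : realType)
    (P : probability T R) (Xs : nat -> {RV P >-> R}) (L W : R) (t : T) : R :=
  1 / (sample_number Xs L W t)%:R * psum Xs (sample_number Xs L W t) t.

(* Main.v *)
(* The estimate fails when |k/n - p| >= p r at the stopping time n, where k is
   the number of successes and r = max(beta, alpha/p). Put A = A_bound,
   h(x) = (1 + x) ln(1 + x) - x and E = (alpha/beta) A h(beta). Since h(x)/x^2
   decreases on (0, 1] to ln 4 - 1 at x = 1, E > ln(2/delta). The processes
     exp(ln(1 + beta) k - beta p n - E) and
     exp(- r k + p (r - r^2/2) n - ln(2/delta))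
   are supermartingales in n, with initial values below delta/2 and equal to
   delta/2. If the estimate fails by excess, the stopping rule (n > L or k > W)
   forces the first to be at least 1; if it fails by defect, the second. Ville's
   inequality for their sum bounds the failure probability below delta. *)

Require Import Defs.
From HB Require Import structures.
From mathcomp Require Import all_boot all_order all_algebra finmap.
From mathcomp Require Import all_classical all_reals all_analysis.
From mathcomp Require Import measurable_realfun ring lra.

Set Implicit Arguments.
Unset Strict Implicit.
Unset Printing Implicit Defensive.

Import Order.TTheory GRing.Theory Num.Theory.
Import numFieldNormedType.Exports.

Local Open Scope classical_set_scope.
Local Open Scope ring_scope.

(** * Elementary bounds on the logarithm and the exponential *)

(** The strict bound [1 + y < expR y] taken at y = - ln (1 + x). *)
Lemma ln1D_gt (R : realType) (x : R) : 0 < x -> x / (1 + x) < ln (1 + x).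
Proof.
move=> x0; have x1 : 0 < 1 + x by lra.
have : 1 + ln (1 + x)^-1 < expR (ln (1 + x)^-1).
  apply: expR_gt1Dx; rewrite lnV ?posrE// oppr_eq0 gt_eqF// ln_gt0//; lra.
rewrite lnV ?posrE// expRN lnK ?posrE//.
suff -> : x / (1 + x) = 1 - (1 + x)^-1 by lra.
by field; rewrite gt_eqF.
Qed.

Lemma is_derive1_ln1D (R : realType) (x : R) :
  0 < 1 + x -> is_derive x 1 (fun y : R => ln (1 + y)) (1 + x)^-1.
Proof.
move=> x1; have dl := is_derive1_ln x1.
have -> : (fun y : R => ln (1 + y)) = @ln R \o (fun y => 1 + y) by [].
apply: is_derive_eq; rewrite /GRing.scale/=; ring.
Qed.

Lemma MVT_is_derive (R : realType) (f df : R -> R) (a b : R) : a < b ->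
  (forall x, a <= x <= b -> is_derive x 1 f (df x)) ->
  exists2 c, a < c < b & f b - f a = df c * (b - a).
Proof.
move=> ab dF.
have dF' x : x \in `]a, b[ -> is_derive x 1 f (df x).
  by rewrite in_itv/= => /andP[ax xb]; apply: dF; rewrite !ltW.
have [|c] := MVT ab dF'; last by rewrite in_itv/=; exists c.
apply: derivable_within_continuous => x; rewrite in_itv/= => abx.
by have [] := dF _ abx.
Qed.

(** The difference [f] vanishes at 0, and its derivative is positive on y > 0 by [ln1D_gt]. *)
Lemma ln1D_gt_pade (R : realType) (x : R) :
  0 < x -> 2 * x < (2 + x) * ln (1 + x).
Proof.
move=> x0.
pose f (y : R) : R := (2 + y) * ln (1 + y) - 2 * y.
have df (y : R) : 0 <= y <= x -> is_derive y 1 f (ln (1 + y) - y / (1 + y)).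
  move=> /andP[y0 _]; have y1 : 0 < 1 + y by lra.
  rewrite /f; have dl := is_derive1_ln1D y1.
  apply: is_derive_eq; rewrite /GRing.scale/=.
  by field; rewrite gt_eqF.
have [c /andP[c0 _]] := MVT_is_derive x0 df.
rewrite /f !addr0 mulr0 ln1 mulr0 !subr0 => e.
by rewrite -subr_gt0 e mulr_gt0// subr_gt0 ln1D_gt.
Qed.

(** The quotient h(y) / y^2 has a negative derivative by [ln1D_gt_pade], so at x it exceeds its
    value at 1, which is ln 4 - 1. *)
Lemma bennett_gt_sqr (R : realType) (x : R) : 0 < x < 1 ->
  (ln 4 - 1) * x ^+ 2 < (1 + x) * ln (1 + x) - x.
Proof.
move=> /andP[x0 x1].
pose f (y : R) : R := ((1 + y) * ln (1 + y) - y) * (y ^+ 2)^-1.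
have df (y : R) : x <= y <= 1 ->
    is_derive y 1 f ((2 * y - (2 + y) * ln (1 + y)) / y ^+ 3).
  move=> /andP[y0 _]; have y1 : 0 < 1 + y by lra.
  have y2 : y != 0 by rewrite gt_eqF//; lra.
  have y3 : y ^+ 2 != 0 by rewrite expf_neq0.
  rewrite /f; have dl := is_derive1_ln1D y1.
  have d2 : is_derive y 1 (fun z : R => z ^+ 2) (2 * y).
    by apply: is_derive_eq; rewrite /GRing.scale/=; ring.
  have dv := is_deriveV (f := fun z : R => z ^+ 2) y3 d2.
  apply: is_derive_eq; rewrite /GRing.scale/=.
  by field; rewrite y2 gt_eqF.
have [c /andP[c0 c1]] := MVT_is_derive x1 df.
rewrite /f expr1n invr1 mulr1.
have -> : (1 + 1) * ln (1 + 1) - 1 = ln 4 - 1 :> R.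
  by rewrite (_ : 4 = (1 + 1) * (1 + 1)) ?lnM ?posrE//; ring.
move=> e; rewrite -ltr_pdivlMr ?exprn_gt0// -subr_lt0 e.
have c2 : 0 < c by lra.
rewrite nmulr_rlt0 ?subr_gt0// ltr_pdivrMr ?exprn_gt0// mul0r subr_lt0.
exact: ln1D_gt_pade.
Qed.

Lemma expRN_le_quad (R : realType) (x : R) :
  0 <= x -> expR (- x) <= 1 - x + x ^+ 2 / 2.
Proof.
rewrite le_eqVlt => /orP[/eqP<-|x0]; first by rewrite oppr0 expR0; lra.
pose f (y : R) : R := 1 - y + y ^+ 2 / 2 - expR (- y).
have df (y : R) : 0 <= y <= x -> is_derive y 1 f (y - 1 + expR (- y)).
  by move=> _; rewrite /f; apply: is_derive_eq; rewrite /GRing.scale/=; field.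
have [c /andP[c0 _]] := MVT_is_derive x0 df.
rewrite /f subr0 expr0n mul0r addr0 oppr0 expR0 subrr !subr0 => e.
by rewrite -subr_ge0 e mulr_ge0//; have := expR_ge1Dx (- c); lra.
Qed.

(** The lower bound makes [A_bound] positive; the upper one, as ln 4 - 1 <= 1/2, absorbs the factor
    1/2 of [lower_exponent]. *)
Lemma ln4_bounds (R : realType) : 1 < ln 4 :> R /\ ln 4 <= 3 / 2 :> R.
Proof.
have e4 : ln 4 = ln 2 + ln 2 :> R.
  by rewrite -lnM ?posrE// (_ : 2 * 2 = 4) //; ring.
split; first by have := ln1D_gt_pade (ltr01 : 0 < 1 :> R); rewrite e4; lra.
suff : ln 2 <= 3 / 4 :> R by rewrite e4; lra.
rewrite -ler_expR lnK ?posrE//.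
(* Six factors exp(1/8) >= 9/8 suffice, since (9/8)^6 > 2. *)
have -> : 3 / 4 = 6%:R * 8^-1 :> R by field.
rewrite expRM_natl; apply: (@le_trans _ _ ((1 + 8^-1) ^+ 6)); first by lra.
by rewrite lerXn2r ?nnegrE ?expR_ge0 ?expR_ge1Dx// addr_ge0.
Qed.

(** * Cylinder events and Ville's inequality *)

Lemma bernoulli_iid_law (d : measure_display) (T : measurableType d)
    (R : realType) (P : probability T R) (X : {RV P >-> R})
    (Xs : nat -> {RV P >-> R}) (p : R) :
  bernoulli_rv p X -> (forall i, same_distribution (Xs i) X) ->
  forall i (x : bool),
    P (Xs i @^-1` [set x%:R]) = (if x then p else 1 - p)%:E.
Proof.
move=> [hX1 hX0] sd i x.
have := sd i [set x%:R] (measurable_set1 _).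
rewrite /distribution /pushforward => ->.
by case: x; [rewrite -hX1|rewrite -hX0].
Qed.

Section cylinder.
Context (d : measure_display) (T : measurableType d) (R : realType).
Context (P : probability T R) (Xs : nat -> {RV P >-> R}).

(** Outcomes with a value outside {0, 1} may escape all cylinders of a given length; this is
    harmless, as cylinders only serve to bound P G from below. *)
Definition cylinder (b : seq bool) : set T :=
  [set t | forall i, (i < size b)%N -> Xs i t = (nth false b i)%:R].

Lemma cylinder_bigcap (b : seq bool) : cylinder b =
  \bigcap_(i in [set` [fset i in iota 0 (size b)]%fset])
    Xs i @^-1` [set (nth false b i)%:R].
Proof.
apply/seteqP; split => t /= H i.
  by rewrite /= !inE mem_iota/= => /H.
by move=> ib; apply: H; rewrite /= !inE mem_iota.
Qed.

Lemma measurable_cylinder (b : seq bool) : measurable (cylinder b).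
Proof.
rewrite cylinder_bigcap; apply: bigcap_measurableType => i _.
rewrite -[X in measurable X]setTI; exact: measurable_funPT.
Qed.

Lemma cylinder_nil : cylinder [::] = setT.
Proof. by apply/seteqP; split => t. Qed.

Lemma cylinder_rcons (b : seq bool) (x : bool) :
  cylinder (rcons b x) = cylinder b `&` Xs (size b) @^-1` [set x%:R].
Proof.
apply/seteqP; split => t.
  move=> H; split; last by rewrite /= H ?size_rcons// nth_rcons ltnn eqxx.
  by move=> i ib; rewrite H ?size_rcons ?nth_rcons ?ib// ltnW.
move=> [H1 H2] i; rewrite size_rcons ltnS leq_eqVlt nth_rcons.
move=> /predU1P[->|ib].
  by rewrite ltnn eqxx.
by rewrite ib; exact: H1.
Qed.

Lemma prob_cylinder_rcons (b : seq bool) (x : bool) :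
  mutually_independent Xs ->
  P (cylinder (rcons b x)) =
    (P (Xs (size b) @^-1` [set x%:R]) * P (cylinder b))%E.
Proof.
move=> indep.
rewrite !cylinder_bigcap !indep => [|i _|i _]; try exact: measurable_set1.
have -> : [fset i in iota 0 (size (rcons b x))]%fset =
    (size b |` [fset i in iota 0 (size b)])%fset :> {fset nat}.
  by apply/fsetP => i; rewrite !inE !mem_iota/= !add0n size_rcons ltnS leq_eqVlt.
rewrite big_fsetU1/=; last by rewrite !inE mem_iota/= ltnn.
rewrite nth_rcons ltnn eqxx; congr (_ * _)%E.
apply: eq_big_seq => i; rewrite !inE mem_iota/= add0n => ib.
by rewrite nth_rcons ib.
Qed.

(* Ville's maximal inequality for a supermartingale [V], by backward induction
   over cylinders: on a cylinder where [V] has reached 1 the bound is void. *)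
Lemma ville_cylinder (p : R) (V : seq bool -> R) (G : set T) (N : nat) :
  mutually_independent Xs ->
  (forall i (x : bool),
     P (Xs i @^-1` [set x%:R]) = (if x then p else 1 - p)%:E) ->
  measurable G ->
  (forall b, 0 <= V b) ->
  (forall b, p * V (rcons b true) + (1 - p) * V (rcons b false) <= V b) ->
  (forall b, size b = N -> (forall n, (n <= N)%N -> V (take n b) < 1) ->
     cylinder b `<=` G) ->
  ((1 - V [::])%:E <= P G)%E.
Proof.
move=> indep law mG V0 Vsup VG.
(* Given the prefix b, G has conditional probability at least 1 - V b, provided V stays below 1 on
   proper prefixes; m counts the observations still to come. *)
suff H m b : (size b + m)%N = N ->
    (forall n, (n < size b)%N -> V (take n b) < 1) ->
    (P (cylinder b) * (1 - V b)%:E <= P (G `&` cylinder b))%E.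
  have := H N [::] erefl.
  by rewrite cylinder_nil probability_setT mul1e setIT; apply.
elim: m b => [|m IH] b bN Vb.
all: have [V1|V1] := leP 1 (V b).
all: try (apply: (@le_trans _ _ 0%E) => //; apply: mule_ge0_le0 => //;
          by rewrite lee_fin subr_le0).
- rewrite addn0 in bN; rewrite setIidr; last first.
    apply: VG => // n; rewrite -bN leq_eqVlt => /predU1P[->|/Vb//].
    by rewrite take_size.
  by rewrite -[leRHS]mule1 lee_wpmul2l// lee_fin lerBlDr lerDl.
- have Vb' x n : (n < size (rcons b x))%N -> V (take n (rcons b x)) < 1.
    rewrite size_rcons ltnS leq_eqVlt -cats1 => /predU1P[->|nb].
      by rewrite take_size_cat.
    by rewrite takel_cat ?Vb// ltnW.
  have IHb x : (P (cylinder (rcons b x)) * (1 - V (rcons b x))%:E <=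
      P (G `&` cylinder (rcons b x)))%E.
    by apply: IH (Vb' x); rewrite size_rcons addSnnS.
  have mI x : measurable (G `&` cylinder (rcons b x)).
    by apply: measurableI => //; exact: measurable_cylinder.
  (* Split on the next observation: the two extensions are disjoint, and inclusion in the cylinder
     of b is enough. *)
  apply: (@le_trans _ _ (P ((G `&` cylinder (rcons b true)) `|`
                           (G `&` cylinder (rcons b false))))).
    rewrite measureU//; last first.
      rewrite !cylinder_rcons; apply/seteqP; split => // t.
      by move=> [[_ [_ /= ->]] [_ [_ /= /eqP]]]; rewrite oner_eq0.
    apply: le_trans (leeD (IHb true) (IHb false)).
    rewrite !prob_cylinder_rcons// !law.
    have /fineK <- : P (cylinder b) \is a fin_num.
      exact: fin_num_measure (measurable_cylinder _).
    rewrite -!EFinM -EFinD lee_fin.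
    by have := ler_wpM2l (fine_ge0 (measure_ge0 P (cylinder b))) (Vsup b); lra.
  apply: le_measure; rewrite ?inE; first exact: measurableU.
    exact: measurableI mG (measurable_cylinder _).
  by rewrite !cylinder_rcons => t [[? []]|[? []]].
Qed.

(** * Measurability of the stopped estimate *)

Lemma measurable_psum (n : nat) : measurable_fun setT (psum Xs n).
Proof. by apply: measurable_sum => i; exact: measurable_funPT. Qed.

Lemma measurable_stops (L W : R) (n : nat) :
  measurable [set t | stops Xs L W t n].
Proof.
have -> : [set t | stops Xs L W t n] =
    [set t | (0 < n)%N /\ (L < n%:R \/ psum Xs n t \in `]W, +oo[ )].
  apply/seteqP; split => t; rewrite /stops/= in_itv/= andbT.
    by move=> /andP[-> /orP].
  by move=> [-> /orP].
case: (ltnP 0 n) => n0; last first.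
  by rewrite (_ : [set t | _] = set0)//; apply/seteqP; split => t //= [].
have [Ln|Ln] := ltP L n%:R.
  rewrite (_ : [set t | _] = setT)//; apply/seteqP; split => t //= _.
  by split => //; left.
rewrite (_ : [set t | _] = setT `&` psum Xs n @^-1` [set` `]W, +oo[]); last first.
  by apply/seteqP; split => t /=; [case=> _ [|]|case=> _; split => //; right].
exact: measurable_psum.
Qed.

Lemma sample_number_eqE (L W : R) (n : nat) :
  [set t | sample_number Xs L W t = n] =
  [set t | stops Xs L W t n] `&`
    \bigcap_(k in `I_n) ~` [set t | stops Xs L W t k].
Proof.
apply/seteqP; split => t /=; rewrite /sample_number; case: ex_minnP => m sm lem.
  by move=> <-; split => // k /= km /lem; rewrite leqNgt km.
move=> [sn ksn]; apply/eqP; rewrite eqn_leq lem// leqNgt; apply/negP => mn.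
exact: ksn mn sm.
Qed.

(** Countable partition by the value of the sample number; on each piece the estimate is a mean of
    fixed sample size. *)
Lemma measurable_p_hat (L W : R) (B : set R) : measurable B ->
  measurable (p_hat Xs L W @^-1` B).
Proof.
move=> mB.
have -> : p_hat Xs L W @^-1` B = \bigcup_n
    ([set t | sample_number Xs L W t = n] `&`
     (setT `&` (fun t => 1 / n%:R * psum Xs n t) @^-1` B)).
  apply/seteqP; split => t; first by exists (sample_number Xs L W t).
  by move=> [n _ [/= <- [_]]].
apply: bigcup_measurable => n _; apply: measurableI.
  rewrite sample_number_eqE; apply: measurableI; first exact: measurable_stops.
  apply: bigcap_measurableType => k _.
  by apply: measurableC; exact: measurable_stops.
by apply: (measurable_funM (measurable_cst _)) => //; exact: measurable_psum.
Qed.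

Lemma psum_cylinder (b : seq bool) (n : nat) (t : T) :
  cylinder b t -> (n <= size b)%N ->
  psum Xs n t = (count id (take n b))%:R.
Proof.
move=> bt; rewrite /psum; elim: n => [|n IH] nb.
  by rewrite big_ord0 take0.
rewrite big_ord_recr/= IH ?(ltnW nb)// (take_nth false nb) -cats1 count_cat/=.
by rewrite addn0 natrD bt.
Qed.

End cylinder.

(** * Exponential supermartingales and their exponents at stopping *)

(** Appending a bit x multiplies V by exp(theta x - c), whose mean is at most 1 by hypothesis. *)
Lemma exp_supermartingale (R : realType) (p theta c E : R) (b : seq bool) :
  p * expR theta + (1 - p) <= expR c ->
  let V (b : seq bool) :=
    expR (theta * (count id b)%:R - c * (size b)%:R - E) in
  p * V (rcons b true) + (1 - p) * V (rcons b false) <= V b.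
Proof.
move=> pc /=; rewrite !size_rcons -!cats1 !count_cat/= !addn0 addn1 -!natr1.
set k := (count id b)%:R; set n := (size b)%:R.
have -> : theta * (k + 1) - c * (n + 1) - E =
    theta + (theta * k - c * n - E) - c by ring.
have -> : theta * k - c * (n + 1) - E = theta * k - c * n - E - c by ring.
rewrite !(expRD _ (- c)) expRD expRN; set v := expR (_ - E).
have -> : p * (expR theta * v / expR c) + (1 - p) * (v / expR c) =
    v * ((p * expR theta + (1 - p)) / expR c).
  by field; rewrite gt_eqF// expR_gt0.
by rewrite ler_piMr ?expR_ge0// ler_pdivrMr ?expR_gt0// mul1r.
Qed.

Lemma upper_exponent (R : realType) (alpha beta p r A n k : R) :
  0 < alpha -> 0 < beta -> 0 < p -> alpha <= p * r -> beta <= r ->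
  0 <= A -> 0 <= n -> A <= n \/ (alpha / beta + alpha) * A <= k ->
  n * (p * (1 + r)) <= k ->
  alpha / beta * A * ((1 + beta) * ln (1 + beta) - beta) <=
    ln (1 + beta) * k - beta * p * n.
Proof.
move=> alpha0 beta0 p0 alphar betar A0 n0 stop nk.
set s := ln (1 + beta); set a := alpha / beta.
have s0 : 0 <= s by rewrite ln_ge0//; lra.
have sb : s <= beta by apply: le_ln1Dx; lra.
have h0 : 0 <= (1 + beta) * s - beta.
  have := ln1D_gt beta0; rewrite ltr_pdivrMr; last by lra.
  by rewrite -/s; lra.
have a0 : 0 <= a by rewrite divr_ge0// ltW.
have ab : alpha = a * beta by rewrite /a divfK// gt_eqF.
case: stop => [An|ak].
  (* Growth per observation. If a <= p, use r >= beta; if p < a, use p r >= a beta and s <= beta. *)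
  have rate : a * ((1 + beta) * s - beta) <= p * ((1 + r) * s - beta).
    have [ap|pa] := leP a p; last by nra.
    apply: (@le_trans _ _ (p * ((1 + beta) * s - beta))); first by nra.
    by rewrite ler_pM2l// lerB// ler_wpM2r// lerD2l.
  have := ler_wpM2l s0 nk.
  have := ler_wpM2l n0 rate.
  have := ler_wpM2r (mulr_ge0 a0 h0) An.
  lra.
(* Here p n <= k / (1 + beta), so the exponent is at least k h / (1 + beta) with h = (1 + beta) s -
   beta, and k >= a (1 + beta) A. *)
rewrite (_ : a + alpha = a * (1 + beta)) in ak; last by rewrite mulrDr mulr1 -ab.
have npk : n * p * (1 + beta) <= k.
  by apply: le_trans nk; rewrite mulrA ler_wpM2l ?lerD2l// mulr_ge0// ltW.
have b1 : 0 < 1 + beta by lra.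
rewrite -(ler_pM2l b1).
have := ler_wpM2r h0 ak.
have := ler_wpM2l (ltW beta0) npk.
lra.
Qed.

Lemma lower_exponent (R : realType) (alpha beta p r A n k : R) :
  0 < alpha -> 0 < beta -> 0 < p -> alpha <= p * r -> beta <= r ->
  0 <= A -> 0 <= n -> A <= n \/ (alpha / beta + alpha) * A <= k ->
  k <= n * (p * (1 - r)) ->
  alpha * beta * A / 2 <= - r * k + p * (r - r ^+ 2 / 2) * n.
Proof.
move=> alpha0 beta0 p0 alphar betar A0 n0 stop kn.
have r0 : 0 < r := lt_le_trans beta0 betar.
(* Inserting k <= n p (1 - r) leaves n p r^2 / 2 as a lower bound for the exponent. *)
suff : alpha * beta * A <= n * p * r ^+ 2.
  have := ler_wpM2l (ltW r0) kn; lra.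
case: stop => [An|ak].
  have : alpha * beta <= p * r * r by rewrite ler_pM// ltW.
  move=> /(ler_wpM2r A0).
  have prr : 0 <= p * r * r by rewrite !mulr_ge0// ltW.
  by have := ler_wpM2r prr An; lra.
have np0 : 0 <= n * p by rewrite mulr_ge0// ltW.
(* In this case n p >= k, as r > 0, and then r^2 >= beta^2 concludes. *)
have anp : alpha / beta * A <= n * p.
  have := mulr_ge0 (ltW alpha0) A0.
  have := mulr_ge0 np0 (ltW r0); lra.
have -> : alpha * beta * A = alpha / beta * A * beta ^+ 2.
  by field; rewrite gt_eqF.
rewrite ler_pM ?sqr_ge0//; last by rewrite lerXn2r// nnegrE ltW.
by rewrite mulr_ge0// divr_ge0// ltW.
Qed.

(** * Coverage probability of the estimate *)

Unset Implicit Arguments.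

Theorem theorem3 (d : measure_display) (T : measurableType d) (R : realType)
    (P : probability T R) (X : {RV P >-> R}) (Xs : nat -> {RV P >-> R})
    (delta alpha beta p L W : R)
    (hdelta : 0 < delta < 1)
    (halpha : 0 < alpha) (halphabeta : alpha < beta) (hbeta : beta < 1)
    (hab : alpha / beta + alpha / 2 <= 1 / 2)
    (hp : 0 < p < 1)
    (hX : bernoulli_rv p X)
    (hXs : iid_as X Xs)
    (hL : A_bound delta alpha beta <= L)
    (hW : B_bound delta alpha beta <= W) :
  ((1 - delta)%:E <
    P [set t | `|p_hat Xs L W t - p|%R < alpha \/
               `|(p_hat Xs L W t - p) / p|%R < beta]%R)%E.
Proof.
move: hdelta hp => /andP[d0 d1] /andP[p0 p1]; have [indep sd] := hXs.
have b0 : 0 < beta := lt_trans halpha halphabeta.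
have [l1 l2] := ln4_bounds R.
set A := A_bound delta alpha beta in hL hW.
set l := ln (2 / delta).
have l0 : 0 < l by rewrite ln_gt0// ltr_pdivlMr//; lra.
have ab0 : 0 < alpha * beta by rewrite mulr_gt0.
have cA : (ln 4 - 1) * (alpha * beta * A) = l.
  rewrite /A /A_bound -/l; field; rewrite !gt_eqF//; lra.
have c0 : 0 < ln 4 - 1 :> R by lra.
have A0 : 0 < A by rewrite -(pmulr_rgt0 _ ab0) -(pmulr_rgt0 _ c0) cA.
pose s := ln (1 + beta); pose h := (1 + beta) * s - beta.
(* [p * r] is [Num.max alpha (beta * p)], the deviation at which the estimate
   fails. *)
pose r := Num.max beta (alpha / p).
have betar : beta <= r by rewrite le_max lexx.
have alphar : alpha <= p * r by rewrite mulrC -ler_pdivrMr// le_max lexx orbT.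
have r0 : 0 < r := lt_le_trans b0 betar.
pose E := alpha / beta * A * h.
have lE : l < E.
  have hh : (ln 4 - 1) * beta ^+ 2 < h by apply: bennett_gt_sqr; rewrite b0.
  have aA : 0 < alpha / beta * A by rewrite !mulr_gt0// invr_gt0.
  have := hh; rewrite -(ltr_pM2l aA) -/E; apply: le_lt_trans.
  by rewrite -cA le_eqVlt; apply/orP; left; apply/eqP; field; rewrite gt_eqF.
pose c := p * (r - r ^+ 2 / 2).
pose V (b : seq bool) : R :=
  expR (s * (count id b)%:R - beta * p * (size b)%:R - E) +
  expR (- r * (count id b)%:R - (- c) * (size b)%:R - l).
have expl : expR (- l) = delta / 2.
  by rewrite expRN lnK ?posrE ?divr_gt0// invf_div.
have Vnil : V [::] < delta.
  rewrite /V /= !mulr0 !subr0 !sub0r expl.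
  have : expR (- E) < expR (- l) by rewrite ltr_expR ltrN2.
  by rewrite expl; lra.
set G := [set t | _].
have mG : measurable G.
  have -> : G = p_hat Xs L W @^-1`
      (`]p - alpha, p + alpha[ `|` `]p - beta * p, p + beta * p[).
    by apply/seteqP; split => t; rewrite /G /= !in_itv/= normrM normfV
      (gtr0_norm p0) ltr_pdivrMr// !ltr_distl.
  by apply: measurable_p_hat; exact: measurableU.
apply: (@lt_le_trans _ _ (1 - V [::])%:E); first by rewrite lte_fin; lra.
(* N exceeds L, so sampling has stopped by time N on every path. *)
pose N := (Num.truncn L).+1.
apply: (ville_cylinder (V := V) (N := N) indep (bernoulli_iid_law hX sd) mG).
- by move=> b; rewrite addr_ge0 ?expR_ge0.
- move=> b; rewrite /V !mulrDr addrACA; apply: lerD; apply: exp_supermartingale.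
    (* As exp s = 1 + beta, the mean is 1 + p beta <= exp(beta p). *)
    rewrite lnK ?posrE; last by lra.
    by apply: le_trans (expR_ge1Dx _); lra.
  (* The quadratic bound on exp(- r) gives a mean of at most 1 - c <= exp(- c). *)
  apply: le_trans (expR_ge1Dx _); rewrite /c.
  have := ler_wpM2l (ltW p0) (expRN_le_quad (ltW r0)); lra.
(* A failing outcome contradicts V < 1 at the prefix of length n, the stopping time: one summand of
   V is at least 1 there. *)
move=> b bN Vb t bt; apply: contrapT => badt.
set n := sample_number Xs L W t.
have [n0 stop nN] : [/\ (0 < n)%N, L < n%:R \/ W < psum Xs n t & (n <= N)%N].
  rewrite /n /sample_number; case: ex_minnP => m /andP[m0 /orP mLW] mN.
  split => //.
  by apply: mN; rewrite /stops real_truncnS_gt// num_real.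
have kE := psum_cylinder (n := n) bt; rewrite bN in kE.
have {Vb} := Vb n nN; apply/negP; rewrite -leNgt /V size_takel ?bN// -kE//.
set k := psum Xs n t in stop *.
have n0' : 0 < n%:R :> R by rewrite ltr0n.
have {}stop : A <= n%:R \/ (alpha / beta + alpha) * A <= k.
  by case: stop => /ltW; [left; exact: le_trans hL _|right; exact: le_trans hW _].
have phatE : p_hat Xs L W t = k / n%:R by rewrite /p_hat -/n -/k mul1r mulrC.
(* Missing both tolerances means |k/n - p| >= p r; the sign of the deviation selects the case. *)
have [up|low] : n%:R * (p * (1 + r)) <= k \/ k <= n%:R * (p * (1 - r)).
  move: badt; rewrite /G /= phatE => /not_orP[/negP + /negP].
  rewrite -!leNgt normrM normfV (gtr0_norm p0) ler_pdivlMr// => ba bb.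
  have : p * r <= `|k / n%:R - p|.
    rewrite /r maxEle; case: ifP => _; last by rewrite mulrC.
    by rewrite mulrC divfK// gt_eqF.
  rewrite ler_normr => /orP[H|H]; [left|right].
    rewrite mulrC -ler_pdivlMr//; lra.
  rewrite mulrC -ler_pdivrMr//; lra.
- apply: (@le_trans _ _ (expR (s * k - beta * p * n%:R - E))); last first.
    by rewrite lerDl expR_ge0.
  apply: le_trans (expR_ge1Dx _); rewrite lerDl subr_ge0.
  exact: (upper_exponent halpha b0 p0 alphar betar (ltW A0) (ltW n0') stop up).
- apply: (@le_trans _ _ (expR (- r * k - (- c) * n%:R - l))); last first.
    by rewrite lerDr expR_ge0.
  apply: le_trans (expR_ge1Dx _); rewrite lerDl subr_ge0.
  have := lower_exponent halpha b0 p0 alphar betar (ltW A0) (ltW n0') stop low.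
  (* From ln 4 <= 3/2, l = (ln 4 - 1) alpha beta A <= alpha beta A / 2. *)
  have := ler_wpM2r (ltW (mulr_gt0 ab0 A0)) l2.
  by rewrite -cA /c; lra.
Qed.
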